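(* Let $m_2<m_1$ be nonnegative integers with $m_1-m_2$ odd, let $n=m_1+m_2+1$, and let $I=(a,b)$ with $0<a<b$. Let $f:[a,b]\to\mathbb{R}$ be such that $f^{(k)}(a)$ and $f^{(k)}(b)$ exist for $k=0,1,\dots,m_1$, $f\in C^{n+2}(I)$, and $f^{(n+1)}(x)\neq 0$ for all $x\in I$. Let $P,Q$ be the unique real polynomials of degree at most $n$ satisfying $$P^{(j)}(a)=f^{(j)}(a)\ (0\le j\le m_1),\qquad P^{(j)}(b)=f^{(j)}(b)\ (0\le j\le m_2),$$ $$Q^{(j)}(a)=f^{(j)}(a)\ (0\le j\le m_2),\qquad Q^{(j)}(b)=f^{(j)}(b)\ (0\le j\le m_1).$$ Then there is a unique $x_0$ with $a<x_0<b$ such that $f(x_0)=\tfrac12\left(P(x_0)+Q(x_0)\right)$.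
   Context: Derivatives at the endpoints $a,b$ are understood as (iterated) one-sided derivatives of $f$ on $[a,b]$. *)

(* Defs.v *)
From HB Require Import structures.
From mathcomp Require Import all_boot all_order all_algebra.
From mathcomp Require Import all_classical all_reals all_analysis.

Set Implicit Arguments.
Unset Strict Implicit.
Unset Printing Implicit Defensive.

Import Order.TTheory GRing.Theory Num.Theory.
Import numFieldNormedType.Exports.

Local Open Scope classical_set_scope.
Local Open Scope ring_scope.

Definition diff_quotient (R : realType) (f : R -> R) (x y : R) : R :=
  (f y - f x) / (y - x).

(* Derivative at x of the restriction of f to A: y tends to x inside A \ {x}.
   For A = `[a, b] it is one-sided at a and at b, and the usual derivative
   in between. *)
Definition derive1_on (R : realType) (A : set R) (f : R -> R) (x : R) : R :=
  lim (diff_quotient f x y @[y --> within A x^']).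

Definition derive1n_on (R : realType) (A : set R) (k : nat) (f : R -> R) :
    R -> R :=
  iter k (derive1_on A) f.

(* Since lim is total, existence of the k-th derivative at x has to be stated
   separately: the (k-1)-st one must exist at all points of A close to x
   (x included), and its difference quotient at x must converge. *)
Fixpoint derivable_n_on (R : realType) (A : set R) (k : nat) (f : R -> R)
    (x : R) : Prop :=
  if k is j.+1 then
    (\forall y \near within A (nbhs x), derivable_n_on A j f y) /\
    cvg (diff_quotient (derive1n_on A j f) x y @[y --> within A x^'])
  else True.

(* Meant for open U: the derivatives are the unrestricted two-sided ones. *)
Definition C_on (R : realType) (U : set R) (k : nat) (f : R -> R) : Prop :=
  forall x, U x ->
    (forall j, (j < k)%N -> derivable (derive1n j f) x 1) /\
    {for x, continuous (derive1n k f)}.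

(* Main.v *)
(* Put phi = (f - P) / ((x - a)^m1 (x - b)^(m2+1)) and
   psi = (f - Q) / ((x - a)^(m2+1) (x - b)^m1). The denominators have degree n, so
   by a generalized Rolle theorem every slope of phi and of psi is a value of
   f^(n+1) / (n+1)!; up to the constant sign s of f^(n+1), both are strictly
   increasing on (a, b). By Peano's form of Taylor's theorem phi tends to 0 at a
   and psi tends to 0 at b, hence s phi > 0 > s psi. Since m1 - m2 - 1 = 2l is
   even,
     2f - P - Q = ((x - a)(x - b))^(m2+1) ((x - a)^(2l) phi + (b - x)^(2l) psi),
   where s times the last factor is strictly increasing, negative near a and
   positive near b. *)

Require Import Defs.
From mathcomp Require Import all_boot all_order all_algebra.
From mathcomp Require Import all_classical all_reals all_analysis.
From mathcomp Require Import ring lra zify.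
Import Order.TTheory GRing.Theory Num.Theory.
Import numFieldNormedType.Exports.

Local Open Scope classical_set_scope.
Local Open Scope ring_scope.

(** * Rolle's theorem with many zeros and zeros at the endpoints *)

(** Rolle's theorem is applied in each gap between consecutive zeros. The zero found in the first
    gap lies before [x1], and those given by induction lie after it, so the new list is again
    strictly increasing. *)
Lemma rolle_path (R : realType) (g g' : R -> R) (x0 : R) (s : seq R) :
  path <%R x0 s ->
  {in `[x0, last x0 s], forall y : R, {for y, continuous g}} ->
  {in `]x0, last x0 s[, forall y : R, is_derive y (1 : R) g (g' y)} ->
  all (fun y => g y == 0) (x0 :: s) ->
  exists s', [/\ size s' = size s, path <%R x0 s',
    all (fun y => y < last x0 s) s' & all (fun y => g' y == 0) s'].
Proof.
elim: s x0 => [|x1 s IH] x0 /=; first by exists [::].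
move=> /andP[x01 x1s] gc gd /and3P[gx0 gx1 gs].
have x1l : x1 <= last x1 s.
  have := order_path_min lt_trans x1s => /allP /= lt1.
  have := mem_last x1 s; rewrite inE => /predU1P[-> //|/lt1 /ltW//].
have [|y|y||s' [ss' s'p s'l s's]] := IH x1 => //.
- move=> yi; apply: gc; move: yi; rewrite !in_itv/= => /andP[? ->].
  by rewrite andbT (le_trans (ltW x01)).
- move=> yi; apply: gd; move: yi; rewrite !in_itv/= => /andP[? ->].
  by rewrite andbT (lt_trans x01).
- by rewrite /= gx1.
have gd' y : y \in `]x0, x1[ -> is_derive y (1 : R) g (g' y).
  move=> yi; apply: gd; move: yi; rewrite !in_itv/= => /andP[-> ?].
  by rewrite (lt_le_trans _ x1l).
have [||||c ci gc0] := @Rolle R g x0 x1 => //.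
- by move=> y /gd' [].
- apply: continuous_in_subspaceT => y; rewrite inE /= => yi.
  apply: gc; move: yi; rewrite !in_itv/= => /andP[-> yx1].
  exact: le_trans x1l.
- by rewrite (eqP gx0) (eqP gx1).
have g'c : g' c = 0 by have [_ <-] := gd' _ ci; have [_ ->] := gc0.
move: ci; rewrite in_itv /= => /andP[x0c cx1].
exists (c :: s'); split => /=.
- by rewrite ss'.
- rewrite x0c /=; case: (s') s'p => //= y s2 /andP[x1y ->].
  by rewrite (lt_trans cx1).
- by rewrite s'l andbT (lt_le_trans cx1).
- by rewrite g'c eqxx.
Qed.

(** The booleans [A] and [B] tell whether [a] and [b] count as additional zeros of [g], so that one
    step of the iteration treats all orders alike. The zeros of [g'] are interior in every case, and
    the bound in successor form also covers an empty list. *)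
Lemma rolle_itv (R : realType) (a b : R) (g g' : R -> R) (A B : bool)
    (s : seq R) :
  a < b ->
  {in `]a, b[, forall y : R, is_derive y (1 : R) g (g' y)} ->
  (A -> {for a, continuous g} /\ g a = 0) ->
  (B -> {for b, continuous g} /\ g b = 0) ->
  sorted <%R s -> all (fun y => y \in `]a, b[) s ->
  all (fun y => g y == 0) s ->
  exists s', [/\ sorted <%R s', all (fun y => y \in `]a, b[) s',
    all (fun y => g' y == 0) s' & (size s + A + B <= (size s').+1)%N].
Proof.
move=> ab gd gA gB ss sab s0.
have sabP y : y \in s -> a < y < b.
  by move=> ys; have := allP sab _ ys; rewrite in_itv.
have [t [tsort tab t0 [tA tB] tsize]] : exists t, [/\ sorted <%R t,
    all (fun y => a <= y <= b) t, all (fun y => g y == 0) t,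
    (a \in t -> A) /\ (b \in t -> B) & size t = (size s + A + B)%N].
  exists (nseq A a ++ s ++ nseq B b); split.
  - have sB : sorted <%R (s ++ nseq B b).
      case: B {gB} => /=; last by rewrite cats0.
      rewrite (sorted_pairwise lt_trans) pairwise_cat /= andbT.
      rewrite -(sorted_pairwise lt_trans) ss andbT.
      by apply/allrelP => x y /sabP /andP[_ xb]; rewrite inE => /eqP ->.
    case: A {gA} => //=; rewrite (path_sortedE lt_trans) sB andbT.
    apply/allP => y; rewrite mem_cat => /orP[/sabP /andP[]//|].
    by rewrite mem_nseq => /andP[_ /eqP ->].
  - apply/allP => y; rewrite !mem_cat !mem_nseq => /or3P[].
    + by move=> /andP[_ /eqP ->]; rewrite lexx ltW.
    + by move=> /sabP /andP[ay yb]; rewrite !ltW.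
    + by move=> /andP[_ /eqP ->]; rewrite lexx ltW.
  - apply/allP => y; rewrite !mem_cat !mem_nseq => /or3P[].
    + by move=> /andP[A0 /eqP ->]; apply/eqP; apply: (gA _).2; case: A A0 {gA}.
    + exact: (allP s0).
    + by move=> /andP[B0 /eqP ->]; apply/eqP; apply: (gB _).2; case: B B0 {gB}.
  - split; rewrite !mem_cat !mem_nseq => /or3P[].
    + by move=> /andP[]; case: A {gA}.
    + by move=> /sabP; rewrite ltxx.
    + by move=> /andP[_ /eqP abE]; rewrite abE ltxx in ab.
    + by move=> /andP[_ /eqP abE]; rewrite abE ltxx in ab.
    + by move=> /sabP; rewrite ltxx andbF.
    + by move=> /andP[]; case: B {gB}.
  - by rewrite !size_cat !size_nseq addnCA addnA.
rewrite -{}tsize; case: t tsort tab t0 tA tB => [|x0 t] tsort tab t0 tA tB.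
  by exists [::].
have x0ab : a <= x0 <= b by have /andP[] := tab.
have lab : a <= last x0 t <= b by apply: (allP tab); exact: mem_last.
have [//|y|y|//|s' [s't s'p s'l s'0]] := @rolle_path R g g' x0 t.
- rewrite in_itv /= => /andP[x0y yl].
  (* Continuity at [a] is available only under [A]. But [y = a] forces the first node to be [a],
     which puts [a] in [t] and so gives [A]; the same happens at [b] with the last node. *)
  have [ya|ya] := eqVneq y a.
    have x0a : x0 = a by apply/eqP; rewrite eq_le -{1}ya x0y; case/andP: x0ab.
    by rewrite ya; apply: (gA _).1; apply: tA; rewrite inE x0a eqxx.
  have [yb|yb] := eqVneq y b.
    have lb : last x0 t = b.
      by apply/eqP; rewrite eq_le -{2}yb yl andbT; case/andP: lab.
    by rewrite yb; apply: (gB _).1; apply: tB; rewrite -{1}lb mem_last.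
  have yab : y \in `]a, b[.
    rewrite in_itv /= !lt_neqAle eq_sym ya yb /=.
    by case/andP: x0ab lab => /le_trans/(_ x0y) -> _ /andP[_ /(le_trans yl) ->].
  have [dg _] := gd y yab.
  exact/differentiable_continuous/derivable1_diffP.
- rewrite in_itv /= => /andP[x0y yl]; apply: gd; rewrite in_itv /=.
  by case/andP: x0ab lab => /le_lt_trans/(_ x0y) -> _ /andP[_ /(lt_le_trans yl) ->].
exists s'; split; [exact: path_sorted s'p| |by []|by rewrite s't].
apply/allP => y ys; rewrite in_itv /=.
have x0y := allP (order_path_min lt_trans s'p) _ ys.
case/andP: x0ab lab => /le_lt_trans/(_ x0y) -> _ /andP[_].
exact/lt_le_trans/(allP s'l).
Qed.

(** Each differentiation loses one zero, but [a] contributes a fresh zero at every order below [p],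
    and [b] at every order below [q]. The invariant at order [i] is [minn i p + minn i q + size s <=
    size t + i], where [t] lists interior zeros of [G i]; at order [n] it leaves at least one
    zero. *)
Lemma generalized_rolle (R : realType) (a b : R) (G : nat -> R -> R)
    (p q n : nat) (s : seq R) :
  a < b -> (p <= n)%N -> (q <= n)%N ->
  (forall j, (j < n)%N -> {in `]a, b[, forall y : R, is_derive y (1 : R) (G j) (G j.+1 y)}) ->
  (forall j, (j < p)%N -> {for a, continuous (G j)} /\ G j a = 0) ->
  (forall j, (j < q)%N -> {for b, continuous (G j)} /\ G j b = 0) ->
  sorted <%R s -> all (fun y => y \in `]a, b[) s ->
  all (fun y => G 0 y == 0) s ->
  (n < p + q + size s)%N ->
  exists2 y, y \in `]a, b[ & G n y = 0.
Proof.
move=> ab pn qn Gd Ga Gb ss sab s0 nsize.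
have [t [tsort tab t0 tsize]] : exists t, [/\ sorted <%R t,
    all (fun y => y \in `]a, b[) t, all (fun y => G n y == 0) t
    & (minn n p + minn n q + size s <= size t + n)%N].
  elim: {-2}n (leqnn n) => [_|i IH iltn].
    by exists s; split; rewrite ?min0n ?addn0.
  have [t [tsort tab t0 tsize]] := IH (ltnW iltn).
  have [t' [? ? ? t's]] := rolle_itv R a b (G i) (G i.+1) (i < p)%N (i < q)%N t
    ab (Gd i iltn) (Ga i) (Gb i) tsort tab t0.
  have minS k : minn i.+1 k = (minn i k + (i < k))%N.
    case: ltnP => ik.
      by rewrite (minn_idPl ik) addn1.
    by rewrite (minn_idPr (leqW ik)) addn0.
  exists t'; split=> //; rewrite !minS; move: tsize t's.
  move: (size t) (size t') (size s) (minn i p) (minn i q)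
    (nat_of_bool (i < p)%N) (nat_of_bool (i < q)%N).
  by clear; lia.
case: t tab t0 tsize {tsort} => [|y t] /=; first by lia.
by move=> /andP[? _] /andP[/eqP ? _] _; exists y.
Qed.

(** * Slopes of the quotients of Hermite interpolation errors *)

(* [h \_ D] extends [h] by [0] outside [D], which turns one-sided limits at the
   endpoints of an interval into two-sided continuity. *)
Lemma patch_continuous (R : realType) (D : set R) (h : R -> R) (c : R) :
  ~ D c -> h x @[x --> within D (nbhs c)] --> (0 : R) ->
  {for c, continuous (h \_ D)} /\ (h \_ D) c = 0.
Proof.
move=> Dc h0; have hc : (h \_ D) c = 0 by rewrite patchE memNset.
split=> //; apply/cvgrPdist_le => e e0; rewrite hc.
have := (cvgrPdist_le _ _).1 h0 e e0; rewrite near_withinE => hx.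
near=> x; rewrite patchE; case: ifPn => [|_].
  by rewrite inE; near: x; exact: hx.
by rewrite subrr normr0 ltW.
Unshelve. all: by end_near. Qed.

Lemma derivn_XsubC_exp_mul (R : comNzRingType) (c : R) (p : {poly R}) (k j : nat) :
  (j < k)%N -> (derivn j (('X - c%:P) ^+ k * p)).[c] = 0.
Proof.
elim: j k p => [|j IH] [|k] p // jk.
  by rewrite derivn0 hornerM horner_exp !hornerE subrr exprS mul0r mul0r.
rewrite derivSn derivM deriv_exp derivB derivX derivC subr0 mul1r.
set r := 'X - c%:P.
have -> : r ^+ k *+ k.+1 * p + r ^+ k.+1 * p^`() = r ^+ k * (p *+ k.+1 + r * p^`()).
  by rewrite exprS mulrDr !mulrnAr mulrnAl mulrCA mulrA.
exact: IH.
Qed.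

Lemma derivn_monic (R : comNzRingType) (p : {poly R}) (m : nat) :
  p \is monic -> size p = m.+1 -> derivn m p = (m`!)%:R%:P.
Proof.
move=> /monicP; rewrite lead_coefE => pm sp; apply/polyP => i.
rewrite coef_derivn coefC; case: i => [|i] /=.
  by rewrite addn0 -[m in p`_m]/(m.+1.-1) -sp pm ffactnn.
by rewrite nth_default ?mul0rn// sp addnS ltnS leq_addr.
Qed.

(** The two-sided [derive1n j f] has no prescribed value at [a] and [b], hence the patch by zero
    there. Every interior point has a neighbourhood on which the patch changes nothing, so
    differentiation is unaffected. *)
Lemma is_derive_patch_derive1nB (R : realType) (a b : R) (f : R -> R) (p : {poly R}) (j : nat) :
  {in `]a, b[, forall x : R, derivable (derive1n j f) x 1} ->
  {in `]a, b[, forall x : R, is_derive x (1 : R)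
    ((fun y => derive1n j f y - (derivn j p).[y]) \_ `]a, b[)
    (((fun y => derive1n j.+1 f y - (derivn j.+1 p).[y]) \_ `]a, b[) x)}.
Proof.
move=> df x xab.
rewrite patchE mem_set// derivnS /= derive1E.
have dp := is_derive_poly (derivn j p) x.
have dfx : is_derive x (1 : R) (derive1n j f) ('D_1 (derive1n j f) x).
  exact: DeriveDef (df x xab) erefl.
apply: near_eq_is_derive (is_deriveB dfx dp).
near=> y; rewrite patchE mem_set//; near: y.
by apply: near_in_itvoo.
Unshelve. all: by end_near. Qed.

(* [phi - (al + be * id)] vanishes at [x1] and [x2] for the affine interpolant of
   [phi], so [f - P - (al + be 'X) w] has [n + 2] zeros in the generalized Rolle
   theorem, and [be] is read off at the resulting zero of its derivative of order
   [n + 1]. *)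
Lemma hermite_quotient_slope (R : realType) (a b : R) (f : R -> R) (P : {poly R}) (p q n : nat) :
  n = (p + q)%N -> (size P <= n.+1)%N ->
  (forall j, (j <= n)%N -> {in `]a, b[, forall x : R, derivable (derive1n j f) x 1}) ->
  (forall j, (j < p)%N -> derive1n j f x @[x --> within `]a, b[ (nbhs a)] --> (derivn j P).[a]) ->
  (forall j, (j < q)%N -> derive1n j f x @[x --> within `]a, b[ (nbhs b)] --> (derivn j P).[b]) ->
  let phi x := (f x - P.[x]) / ((x - a) ^+ p * (x - b) ^+ q) in
  forall x1 x2, a < x1 -> x1 < x2 -> x2 < b ->
  exists2 y, y \in `]a, b[ &
    phi x2 - phi x1 = derive1n n.+1 f y / n.+1`!%:R * (x2 - x1).
Proof.
move=> nE sP df fa fb phi x1 x2 ax1 x12 x2b.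
have ab : a < b by rewrite (lt_trans ax1) ?(lt_trans x12).
pose w : {poly R} := ('X - a%:P) ^+ p * ('X - b%:P) ^+ q.
have wE x : w.[x] = (x - a) ^+ p * (x - b) ^+ q.
  by rewrite hornerM !horner_exp !hornerE.
have wm : w \is monic by rewrite rpredM// rpredX// monicXsubC.
have sw : size w = n.+1.
  by rewrite size_monicM ?size_exp_XsubC ?monic_neq0 ?rpredX ?monicXsubC// addnS nE.
pose be := (phi x2 - phi x1) / (x2 - x1).
pose al := phi x1 - be * x1.
pose r := P + (al *: w + be *: ('X * w)).
(* [P] and [w] have degree at most [n] and disappear; only the monic ['X * w], of degree [n.+1],
   survives. *)
have rn1 : derivn n.+1 r = (be * n.+1`!%:R)%:P.
  rewrite /r !derivnD !derivnZ (derivn_poly0 sP) (@derivn_poly0 _ w) ?sw//.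
  rewrite scaler0 !add0r.
  have Xwm : 'X * w \is monic by rewrite rpredM// monicX.
  have sXw : size ('X * w) = n.+2 by rewrite mulrC size_mulX ?monic_neq0// sw.
  by rewrite (derivn_monic _ _ _ Xwm sXw) -mul_polyC -polyCM.
(* The correction added to [P] keeps the factor of [w] at each endpoint, so it leaves the
   interpolation conditions there intact. *)
have rw (w' : {poly R}) c k j : (exists w'', w' = ('X - c%:P) ^+ k * w'') ->
    (j < k)%N -> (derivn j (al *: w' + be *: ('X * w'))).[c] = 0.
  move=> [w'' ->] jk; rewrite derivnD !derivnZ mulrCA hornerD !hornerZ.
  by rewrite !derivn_XsubC_exp_mul// !mulr0 addr0.
have rx x : a < x < b -> phi x = al + be * x -> f x - r.[x] = 0.
  move=> /andP[ax xb] phix.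
  have wx : w.[x] != 0 
    by rewrite wE mulf_neq0 ?expf_neq0 ?subr_eq0 ?(gt_eqF ax) ?(lt_eqF xb).
  rewrite /r !hornerD !hornerZ (hornerM 'X w) hornerX opprD addrA.
  apply/eqP; rewrite subr_eq0; apply/eqP.
  have -> : f x - P.[x] = phi x * w.[x] by rewrite wE /phi -wE divfK.
  by rewrite phix mulrDl mulrA.
have ex (c : R) k j : ~ `]a, b[%classic c ->
    (derive1n j f x @[x --> within `]a, b[ (nbhs c)] --> (derivn j P).[c]) ->
    (exists w'', w = ('X - c%:P) ^+ k * w'') -> (j < k)%N ->
  {for c, continuous ((fun y => derive1n j f y - (derivn j r).[y]) \_ `]a, b[)} /\
  ((fun y => derive1n j f y - (derivn j r).[y]) \_ `]a, b[) c = 0.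
  move=> abc fc wc jk; apply: patch_continuous => //.
  have -> : (0 : R) = (derivn j P).[c] - (derivn j r).[c].
    by rewrite derivnD hornerD (rw w c k j) // addr0 subrr.
  apply: cvgB => //; apply: cvg_within_filter.
  exact/differentiable_continuous/derivable1_diffP/derivable_horner.
(* The count is [p] zeros at [a], [q] at [b], and the two interior ones [x1], [x2]: [n + 2] in all,
   one more than the order [n.+1]. *)
have [|||j jn|j jp|j jq|||||y yab] := @generalized_rolle R a b
    (fun j => (fun y => derive1n j f y - (derivn j r).[y]) \_ `]a, b[)
    p q n.+1 [:: x1; x2] => //.
- by rewrite nE -addnS leq_addr.
- by rewrite nE -addSn leq_addl.
- exact: is_derive_patch_derive1nB (df j jn).
- apply: (ex a p) => //; [by rewrite /= in_itv /= ltxx| exact: fa|].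
  by eexists; reflexivity.
- apply: (ex b q) => //; [by rewrite /= in_itv /= ltxx andbF| exact: fb|].
  by rewrite /w mulrC; eexists; reflexivity.
- by rewrite /= x12.
- by rewrite /= !in_itv /= ax1 x2b (lt_trans ax1)// (lt_trans x12).
- have x1i : a < x1 < b by rewrite ax1 (lt_trans x12).
  have x2i : a < x2 < b by rewrite (lt_trans ax1)//.
  have phi1 : phi x1 = al + be * x1 by rewrite /al subrK.
  have phi2 : phi x2 = al + be * x2.
    by rewrite /al /be; field; rewrite subr_eq0 gt_eqF.
  by rewrite /= !patchE !mem_set /= ?in_itv//= !rx ?eqxx.
- by rewrite nE /= addn2.
rewrite patchE mem_set// rn1 hornerC => /eqP; rewrite subr_eq0 => /eqP fy.
by exists y => //; rewrite fy mulfK ?divfK // subr_eq0 gt_eqF.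
Qed.

(** * Endpoint behaviour: one-sided derivatives and Peano's estimate *)

Lemma derive1n_on_itvoo (R : realType) (a b : R) (f : R -> R) (k : nat) :
  (forall j, (j < k)%N -> {in `]a, b[, forall x : R, derivable (derive1n j f) x 1}) ->
  {in `]a, b[, forall x : R, derive1n_on `[a, b] k f x = derive1n k f x}.
Proof.
elim: k => [//|k IH] df x xab.
have {}IH := IH (fun j jk => df j (ltnW jk)).
(* Caratheodory's form of the derivative: [g] is continuous at [x] and equals the difference
   quotient elsewhere, so the limit is read off as [g x]. *)
have [g [gE gc gx]] := (is_derive1_caratheodory _ _ _).1 (DeriveDef (df k (ltnSn k) x xab) erefl).
rewrite [RHS]/= derive1E -gx [LHS]/derive1n_on iterS -/(derive1n_on _ _ _) /derive1_on.
have xnear : \forall y \near x, y \in `]a, b[ by apply: near_in_itvoo.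
have -> : within `[a, b] x^' = x^'.
  apply/seteqP; split => A xA.
    have {}xA : \forall y \near x, y != x -> y \in `[a, b] -> A y by exact: xA.
    suff : \forall y \near x, y != x -> A y by exact.
    near=> y => yx; have yA : y != x -> y \in `[a, b] -> A y by near: y.
    apply: yA => //; have : y \in `]a, b[ by near: y.
    by rewrite !in_itv/= => /andP[/ltW -> /ltW ->].
  have {}xA : \forall y \near x, y != x -> A y by exact: xA.
  suff : \forall y \near x, y != x -> y \in `[a, b] -> A y by exact.
  near=> y => yx _; have yA : y != x -> A y by near: y.
  exact: yA.
have gcw : g y @[y --> x^'] --> g x.
  by apply: cvg_trans gc; apply: cvg_app; exact: cvg_within.
apply/cvg_lim => //; apply: cvg_trans gcw.
have e : {near x^', g =1 diff_quotient (derive1n_on `[a, b] k f) x}.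
  rewrite near_withinE; near=> y => yx.
  have yab : y \in `]a, b[ by near: y.
  by rewrite /diff_quotient !IH// gE mulfK// subr_eq0.
exact: near_eq_cvg e.
Unshelve. all: by end_near. Qed.

(** Approaching [c] through the open interval allows the restricted derivative at [y] to be replaced
    by the ordinary one. At [c] itself the one-sided value has to stay. *)
Lemma derivable_n_on_cvg_quotient (R : realType) (a b c : R) (f : R -> R) (k : nat) :
  ~ `]a, b[%classic c ->
  (forall j, (j < k)%N -> {in `]a, b[, forall x : R, derivable (derive1n j f) x 1}) ->
  derivable_n_on `[a, b] k.+1 f c ->
  (derive1n k f y - derive1n_on `[a, b] k f c) / (y - c)
    @[y --> within `]a, b[ (nbhs c)] --> derive1n_on `[a, b] k.+1 f c.
Proof.
move=> ncab df [_ cvc].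
have {}cvc : diff_quotient (derive1n_on `[a, b] k f) c y @[y --> within `[a, b] c^']
    --> derive1n_on `[a, b] k.+1 f c by exact: cvc.
have sub : within `]a, b[ (nbhs c) `=>` within `[a, b] c^'.
  move=> A cA.
  have {}cA : \forall y \near c, y != c -> y \in `[a, b] -> A y by exact: cA.
  suff : \forall y \near c, y \in `]a, b[ -> A y by exact.
  near=> y => yab.
  have yA : y != c -> y \in `[a, b] -> A y by near: y.
  apply: yA; first by apply: contra_notN ncab => /eqP <-.
  by move: yab; rewrite !in_itv/= => /andP[/ltW -> /ltW ->].
have e : {near within `]a, b[ (nbhs c), diff_quotient (derive1n_on `[a, b] k f) c =1
    (fun y => (derive1n k f y - derive1n_on `[a, b] k f c) / (y - c))}.
  rewrite near_withinE; near=> y => yab.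
  by rewrite /diff_quotient (derive1n_on_itvoo _ a b).
exact: cvg_trans (near_eq_cvg e) (cvg_trans (cvg_app _ sub) cvc).
Unshelve. all: by end_near. Qed.

Lemma cvg_quotient_cvg (R : realType) (D : set R) (c l d : R) (g : R -> R) :
  ~ D c ->
  (g y - l) / (y - c) @[y --> within D (nbhs c)] --> d ->
  g y @[y --> within D (nbhs c)] --> l.
Proof.
move=> Dc gd.
have yc : y - c @[y --> within D (nbhs c)] --> (0 : R).
  rewrite -(subrr c); apply: cvgB; last exact: cvg_cst.
  exact: cvg_within.
have : (g y - l) / (y - c) * (y - c) + l @[y --> within D (nbhs c)] --> d * 0 + l.
  by apply: cvgD; [exact: cvgM|exact: cvg_cst].
rewrite mulr0 add0r; apply: cvg_trans.
have e : {near within D (nbhs c),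
    (fun y => (g y - l) / (y - c) * (y - c) + l) =1 g}.
  rewrite near_withinE; near=> y => yD.
  rewrite divfK ?subrK// subr_eq0; apply/eqP => yc0.
  by apply: Dc; rewrite -yc0.
exact: near_eq_cvg e.
Unshelve. all: by end_near. Qed.

(** By induction the bound holds for [G 1] with exponent one less. The mean value theorem between
    [c] and [y] gives [|G 0 y| = |G 1 z| |y - c|] with [z] no farther from [c] than [y], so the
    exponent rises by one and the constant [e] is kept. As [c] is an endpoint, the segment lies on
    one side of it. *)
Lemma peano_vanishing (R : realType) (a b c : R) (G : nat -> R -> R) (p : nat) :
  a <= c <= b -> ~ `]a, b[%classic c ->
  (forall j, (j < p)%N -> {in `]a, b[, forall y : R, is_derive y (1 : R) (G j) (G j.+1 y)}) ->
  (forall j, (j <= p)%N -> {for c, continuous (G j)} /\ G j c = 0) ->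
  (forall e, 0 < e -> \forall y \near within `]a, b[ (nbhs c), `|G p y| <= e * `|y - c|) ->
  forall e, 0 < e ->
  \forall y \near within `]a, b[ (nbhs c), `|G 0 y| <= e * `|y - c| ^+ p.+1.
Proof.
move=> cab ncab; elim: p G => [|p IH] G Gd Gc Gp e e0.
  by near do rewrite expr1; exact: Gp.
have := IH (fun j => G j.+1) (fun j => Gd j.+1) (fun j => Gc j.+1) Gp e e0.
rewrite !near_withinE => /nbhs_ballP[d /= d0 dG].
apply/nbhs_ballP; exists d => //= y dy yab.
have [G0c G0] := Gc 0%N isT.
have {}dy : `|c - y| < d by [].
have yc : y != c by apply/eqP => yc; apply: ncab; rewrite -yc.
move: (yab); rewrite /= in_itv/= => /andP[ay yb]; case/andP: cab => ac cb.
have cG z : z \in `]a, b[ -> {for z, continuous (G 0%N)}.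
  move=> zab; have [dg _] := Gd 0%N isT z zab.
  exact/differentiable_continuous/derivable1_diffP.
have [z [zab zc Gz]] : exists z, [/\ z \in `]a, b[, `|z - c| <= `|y - c|
    & `|G 0%N y| = `|G 1%N z| * `|y - c|].
  have [cy|cy|cyE] := ltgtP c y; last by rewrite cyE eqxx in yc.
  - have zi z : z \in `]c, y[ -> z \in `]a, b[.
      by rewrite !in_itv/= => /andP[/(le_lt_trans ac) -> /lt_trans ->].
    have [|z zcy Gz] := @MVT R (G 0%N) (G 1%N) c y cy (fun z zcy => Gd 0%N isT z (zi z zcy)).
      apply: continuous_in_subspaceT => z; rewrite inE /= in_itv/= => /andP[cz zy].
      have [->//|zc] := eqVneq z c.
      apply: cG; rewrite in_itv/= (le_lt_trans zy yb) andbT (le_lt_trans ac)//.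
      by rewrite lt_neqAle eq_sym zc.
    exists z; split; first exact: zi.
      move: zcy; rewrite in_itv/= => /andP[cz zy].
      by rewrite !gtr0_norm ?subr_gt0// lerD2r ltW.
    by rewrite -normrM -Gz G0 subr0.
  - have zi z : z \in `]y, c[ -> z \in `]a, b[.
      by rewrite !in_itv/= => /andP[/(lt_trans ay) -> /lt_le_trans ->].
    have [|z zcy Gz] := @MVT R (G 0%N) (G 1%N) y c cy (fun z zcy => Gd 0%N isT z (zi z zcy)).
      apply: continuous_in_subspaceT => z; rewrite inE /= in_itv/= => /andP[yz zc].
      have [->//|zcE] := eqVneq z c.
      apply: cG; rewrite in_itv/= (lt_le_trans ay yz) /= (lt_le_trans _ cb)//.
      by rewrite lt_neqAle zcE.
    exists z; split; first exact: zi.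
      move: zcy; rewrite in_itv/= => /andP[yz zc].
      by rewrite !ltr0_norm ?subr_lt0// lerN2 lerD2r ltW.
    by rewrite (distrC y) -normrM -Gz G0 sub0r normrN.
rewrite Gz exprSr mulrA ler_wpM2r//.
apply: (le_trans (dG z _ _)) => //.
  by rewrite /ball /= distrC (le_lt_trans zc)// distrC.
by rewrite ler_wpM2l ?(ltW e0)// lerXn2r ?nnegrE.
Unshelve. all: by end_near. Qed.

Lemma derivable_n_on_cvg (R : realType) (a b c : R) (f : R -> R) (k : nat) :
  ~ `]a, b[%classic c ->
  (forall j, (j < k)%N -> {in `]a, b[, forall x : R, derivable (derive1n j f) x 1}) ->
  derivable_n_on `[a, b] k.+1 f c ->
  derive1n k f y @[y --> within `]a, b[ (nbhs c)] --> derive1n_on `[a, b] k f c.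
Proof.
move=> ncab df fc.
exact: cvg_quotient_cvg (derivable_n_on_cvg_quotient _ _ _ _ _ _ ncab df fc).
Qed.

(** Differentiability at [c] to order [m.+1] does not make [derive1n m.+1 f] converge at [c]. The
    top order therefore enters only through the difference quotient of order [m], which is exactly
    the base estimate that [peano_vanishing] asks for. *)
Lemma hermite_endpoint (R : realType) (a b c : R) (f : R -> R) (P : {poly R}) (m : nat) :
  a <= c <= b -> ~ `]a, b[%classic c ->
  (forall j, (j <= m)%N -> {in `]a, b[, forall x : R, derivable (derive1n j f) x 1}) ->
  (forall k, (k <= m.+1)%N -> derivable_n_on `[a, b] k f c) ->
  (forall j, (j <= m.+1)%N -> (derivn j P).[c] = derive1n_on `[a, b] j f c) ->
  forall e, 0 < e -> \forall y \near within `]a, b[ (nbhs c),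
    `|f y - P.[y]| <= e * `|y - c| ^+ m.+1.
Proof.
move=> cab ncab df fc Pc e e0.
have quo j : (j <= m)%N ->
    (derive1n j f y - (derivn j P).[c]) / (y - c)
      @[y --> within `]a, b[ (nbhs c)] --> (derivn j.+1 P).[c].
  move=> jm; rewrite (Pc j (leqW jm)) (Pc j.+1 jm).
  apply: derivable_n_on_cvg_quotient => //; last exact: fc.
  by move=> i ij; apply: df; rewrite (leq_trans (ltnW ij)).
have lim_f j : (j <= m)%N ->
    derive1n j f x @[x --> within `]a, b[ (nbhs c)] --> (derivn j P).[c].
  by move=> /quo; exact: cvg_quotient_cvg.
pose G j := (fun y => derive1n j f y - (derivn j P).[y]) \_ `]a, b[.
have Gc j : (j <= m)%N -> {for c, continuous (G j)} /\ G j c = 0.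
  move=> jm; apply: patch_continuous => //.
  rewrite -(subrr (derivn j P).[c]); apply: cvgB; first exact: lim_f.
  apply: cvg_within_filter.
  exact/differentiable_continuous/derivable1_diffP/derivable_horner.
have Gm e' : 0 < e' -> \forall y \near within `]a, b[ (nbhs c), `|G m y| <= e' * `|y - c|.
  move=> e'0.
  (* The quotients at [c] of the [m]-th derivatives of [f] and of [P] have the same limit, so their
     difference tends to zero. *)
  have [g [gE gc gx]] := (is_derive1_caratheodory _ _ _).1 (is_derive_poly (derivn m P) c).
  have gcw : g y @[y --> within `]a, b[ (nbhs c)] --> g c.
    by apply: cvg_within_filter; exact: gc.
  have := (cvgrPdist_le _ _).1 (cvgB (quo m (leqnn m)) gcw) e' e'0.
  rewrite gx -derivnS subrr !near_withinE => H; near=> y.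
  have : y \in `]a, b[ ->
      `|0 - ((derive1n m f y - (derivn m P).[c]) / (y - c) - g y)| <= e'.
    by near: y; exact: H.
  move=> Hy yab; have yc : y - c != 0 by rewrite subr_eq0; apply: contra_notN ncab => /eqP <-.
  move: (Hy yab); rewrite sub0r normrN /G patchE mem_set// => {}Hy.
  have -> : derive1n m f y - (derivn m P).[y] =
      ((derive1n m f y - (derivn m P).[c]) / (y - c) - g y) * (y - c).
    by rewrite mulrBl divfK// -gE opprB addrA subrK.
  by rewrite normrM ler_wpM2r.
have := peano_vanishing _ _ _ _ G m cab ncab
  (fun j jm => is_derive_patch_derive1nB _ _ _ _ P _ (df j (ltnW jm))) Gc Gm e e0.
rewrite !near_withinE => H; near=> y => yab.
have : y \in `]a, b[ -> `|G 0%N y| <= e * `|y - c| ^+ m.+1 by near: y; exact: H.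
by move=> /(_ yab); rewrite /G patchE mem_set.
Unshelve. all: by end_near. Qed.

(** Within distance [r = |c - c'| / 2] of [c], the other factor satisfies [|y - c'| >= r]. Dividing
    by it costs at most [r ^+ q], so the estimate is invoked with [e * r ^+ q]. *)
Lemma hermite_quotient_vanishing (R : realType) (a b c c' : R) (f : R -> R)
    (P : {poly R}) (p q : nat) :
  c != c' ->
  (forall e, 0 < e -> \forall y \near within `]a, b[ (nbhs c),
     `|f y - P.[y]| <= e * `|y - c| ^+ p) ->
  forall e, 0 < e -> exists2 d, 0 < d & forall y, a < y < b -> y != c -> `|y - c| < d ->
    `|(f y - P.[y]) / ((y - c) ^+ p * (y - c') ^+ q)| <= e.
Proof.
move=> cc' fP e e0.
pose r := `|c - c'| / 2.
have r0 : 0 < r by rewrite divr_gt0// normr_gt0 subr_eq0.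
have := fP (e * r ^+ q) (mulr_gt0 e0 (exprn_gt0 _ r0)).
rewrite near_withinE => /nbhs_ballP[d /= d0 dfP].
exists (Num.min d r); first by rewrite lt_min d0.
move=> y yab yc; rewrite lt_min => /andP[yd yr].
have yc0 : 0 < `|y - c| by rewrite normr_gt0 subr_eq0.
have ryc' : r <= `|y - c'|.
  have : `|c - c'| <= `|c - y| + `|y - c'| by rewrite -[c - c'](subrKA y) ler_normD.
  have -> : `|c - c'| = r + r by rewrite /r -splitr.
  by rewrite (distrC c); lra.
have yc'0 : 0 < `|y - c'| by exact: lt_le_trans ryc'.
rewrite normrM normfV normrM !normrX ler_pdivrMr ?mulr_gt0 ?exprn_gt0//.
apply: le_trans (dfP y _ _) _; rewrite ?in_itv//=.
  by rewrite /ball /= distrC.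
rewrite -mulrA ler_wpM2l ?(ltW e0)// mulrC ler_wpM2l ?exprn_ge0//.
by rewrite lerXn2r ?nnegrE ?(ltW r0).
Qed.

(** * Weighted sums of increasing functions that vanish at opposite endpoints *)

(** A negative value at [z] would keep [U] below [U z] to the left of [z], against the limit zero at
    [a]. Strict positivity then follows by comparing [x] with the midpoint of [a] and [x]. *)
Lemma increasing_vanishing_gt0 (R : realType) (a b : R) (U : R -> R) :
  (forall x y, a < x -> x < y -> y < b -> U x < U y) ->
  (forall e, 0 < e -> exists2 d, 0 < d & forall y, a < y < b -> `|y - a| < d -> `|U y| <= e) ->
  forall x, a < x < b -> 0 < U x.
Proof.
move=> Ui U0 x /andP[ax xb].
have ge0 z : a < z < b -> 0 <= U z.
  move=> /andP[az zb]; rewrite leNgt; apply/negP => Uz.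
  have [|d d0 dU] := U0 (- U z); first by rewrite oppr_gt0.
  pose y := a + Num.min d (z - a) / 2.
  have m0 : 0 < Num.min d (z - a) by rewrite lt_min d0 subr_gt0.
  have md : Num.min d (z - a) <= d by rewrite ge_min lexx.
  have mz : Num.min d (z - a) <= z - a by rewrite ge_min lexx orbT.
  have ay : a < y by rewrite /y; lra.
  have yz : y < z by rewrite /y; lra.
  have := dU y; rewrite ay (lt_trans yz zb) gtr0_norm ?subr_gt0// => /(_ isT).
  have -> : y - a < d by rewrite /y; lra.
  move=> /(_ isT); have := Ui _ _ ay yz zb; rewrite ler_norml; lra.
have az : a < (a + x) / 2 by lra.
have zx : (a + x) / 2 < x by lra.
by apply: le_lt_trans (Ui _ _ az zx xb); apply: ge0; rewrite az (lt_trans zx).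
Qed.

(** Close to [a] the first term is arbitrarily small, while the second stays below its fixed
    negative value at the midpoint [c]. *)
Lemma balance_lt0 (R : realType) (a b : R) (k : nat) (U V : R -> R) :
  a < b ->
  (forall x y, a < x -> x < y -> y < b -> V x < V y) ->
  (forall x, a < x < b -> 0 < U x) -> (forall x, a < x < b -> V x < 0) ->
  (forall e, 0 < e -> exists2 d, 0 < d & forall y, a < y < b -> `|y - a| < d -> `|U y| <= e) ->
  exists2 x, a < x < b & (x - a) ^+ k * U x + (b - x) ^+ k * V x < 0.
Proof.
move=> ab Vi Up Vn U0.
pose c := (a + b) / 2.
have ac : a < c by rewrite /c; lra.
have cb : c < b by rewrite /c; lra.
have Vc : V c < 0 by rewrite Vn// ac.
have ba0 : 0 < (b - a) ^+ k by rewrite exprn_gt0 ?subr_gt0.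
have bc0 : 0 < (b - c) ^+ k by rewrite exprn_gt0 ?subr_gt0.
(* Chosen so that [(b - a) ^+ k * e] equals the absolute value of the second term at [c]; the strict
   inequality comes from [V y < V c]. *)
pose e := (b - c) ^+ k * (- V c) / (b - a) ^+ k.
have e0 : 0 < e by rewrite divr_gt0 ?mulr_gt0 ?oppr_gt0.
have [d d0 dU] := U0 e e0.
pose y := a + Num.min d (c - a) / 2.
have m0 : 0 < Num.min d (c - a) by rewrite lt_min d0 subr_gt0.
have md : Num.min d (c - a) <= d by rewrite ge_min lexx.
have mz : Num.min d (c - a) <= c - a by rewrite ge_min lexx orbT.
have ay : a < y by rewrite /y; lra.
have yc : y < c by rewrite /y; lra.
have yb : y < b by rewrite (lt_trans yc).
have yab : a < y < b by rewrite ay.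
exists y => //.
have Uy : U y <= e.
  apply: le_trans (ler_norm _) (dU y yab _).
  by rewrite gtr0_norm ?subr_gt0// /y; lra.
have le1 : (y - a) ^+ k * U y <= (b - a) ^+ k * e.
  rewrite ler_pM ?exprn_ge0 ?subr_ge0 ?(ltW ay) ?(ltW (Up _ _))//.
  by rewrite lerXn2r ?nnegrE ?subr_ge0 ?(ltW ay) ?(ltW ab)// lerD2r ltW.
have le2 : (b - c) ^+ k * (- V c) < (b - y) ^+ k * (- V y).
  have /le_lt_trans : (b - c) ^+ k * (- V c) <= (b - y) ^+ k * (- V c).
    rewrite ler_wpM2r ?oppr_ge0 ?(ltW Vc)//.
    by rewrite lerXn2r ?nnegrE ?subr_ge0 ?(ltW cb) ?(ltW yb)// lerD2l lerN2 ltW.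
  apply; rewrite ltr_pM2l ?exprn_gt0 ?subr_gt0// ltrN2; exact: Vi.
have : (b - a) ^+ k * e = (b - c) ^+ k * (- V c).
  by rewrite mulrC divfK ?gt_eqF.
by move: le1 le2; rewrite !mulrN; lra.
Qed.

(** Here [U] is positive and [V] negative. The first term is a product of nonnegative nondecreasing
    factors; in the second the weight [(b - x) ^+ k] does not increase but multiplies a negative
    factor, so that term increases too. *)
Lemma balance_sign_change (R : realType) (a b : R) (k : nat) (U V : R -> R) :
  a < b ->
  (forall x y, a < x -> x < y -> y < b -> U x < U y) ->
  (forall x y, a < x -> x < y -> y < b -> V x < V y) ->
  (forall e, 0 < e -> exists2 d, 0 < d & forall y, a < y < b -> `|y - a| < d -> `|U y| <= e) ->
  (forall e, 0 < e -> exists2 d, 0 < d & forall y, a < y < b -> `|y - b| < d -> `|V y| <= e) ->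
  let h x := (x - a) ^+ k * U x + (b - x) ^+ k * V x in
  [/\ forall x y, a < x -> x < y -> y < b -> h x < h y,
      exists2 x, a < x < b & h x < 0 & exists2 x, a < x < b & 0 < h x].
Proof.
move=> ab Ui Vi U0 V0 h.
have refl x : a < x < b -> a < a + b - x < b by move=> /andP[? ?]; apply/andP; split; lra.
pose V' x := - V (a + b - x).
have V'i x y : a < x -> x < y -> y < b -> V' x < V' y.
  by move=> *; rewrite /V' ltrN2 Vi//; lra.
have V'0 e : 0 < e -> exists2 d, 0 < d & forall y, a < y < b -> `|y - a| < d -> `|V' y| <= e.
  move=> /V0[d d0 dV]; exists d => // y yab yd; rewrite /V' normrN dV ?refl//.
  by rewrite (_ : _ - b = - (y - a)) ?normrN//; lra.
have Up := @increasing_vanishing_gt0 _ _ _ _ Ui U0.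
have V'p := @increasing_vanishing_gt0 _ _ _ _ V'i V'0.
have reflK x : a + b - (a + b - x) = x by lra.
have Vn x : a < x < b -> V x < 0.
  by move=> /refl/V'p; rewrite /V' oppr_gt0 reflK.
split.
- move=> x y ax xy yb.
  have xab : a < x < b by rewrite ax (lt_trans xy).
  have yab : a < y < b by rewrite yb (lt_trans ax).
  rewrite /h ler_ltD//.
    rewrite ler_pM ?exprn_ge0 ?subr_ge0 ?(ltW ax) ?(ltW (Up _ _)) ?(ltW (Ui _ _ _ _ _))//.
    by rewrite lerXn2r ?nnegrE ?subr_ge0 ?(ltW ax) ?(ltW (lt_trans ax xy))// lerD2r ltW.
  apply: (@le_lt_trans _ _ ((b - y) ^+ k * V x)).
    rewrite ler_wnM2r ?(ltW (Vn _ _))//.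
    by rewrite lerXn2r ?nnegrE ?subr_ge0 ?(ltW yb) ?(ltW (lt_trans xy yb))// lerD2l lerN2 ltW.
  by rewrite ltr_pM2l ?exprn_gt0 ?subr_gt0 ?Vi.
- exact: balance_lt0.
- (* Reflection about the midpoint exchanges [a] with [b], and [U] with [- V]. *)
  have [||||x xab hx] := @balance_lt0 R a b k V' (fun x => - U (a + b - x)) ab => //.
  + by move=> x y ax xy yb; rewrite ltrN2 Ui//; lra.
  + by move=> x xab; rewrite oppr_lt0 Up ?refl.
  + exists (a + b - x); first exact: refl.
    have e1 : a + b - x - a = b - x by ring.
    have e2 : b - (a + b - x) = x - a by ring.
    by move: hx; rewrite /h e1 e2 /V' !mulrN -opprD oppr_lt0 addrC.
Qed.

(** * Constant sign of the derivative of order n + 1 *)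

(** The intermediate value theorem excludes a change of sign. Returning the sign as a factor [s]
    lets both signs be handled by one argument. *)
Lemma continuous_neq0_sign (R : realType) (a b : R) (h : R -> R) :
  a < b ->
  {in `]a, b[, forall x : R, {for x, continuous h}} ->
  {in `]a, b[, forall x : R, h x != 0} ->
  exists2 s, s * s = 1 & {in `]a, b[, forall x : R, 0 < s * h x}.
Proof.
move=> ab ch h0; pose c := (a + b) / 2.
have cab : c \in `]a, b[ by rewrite in_itv/= /c; lra.
exists (Num.sg (h c)); first by rewrite -expr2 sqr_sg h0.
move=> x xab; set s := Num.sg _.
have s0 : s != 0 by rewrite sgr_eq0 h0.
rewrite lt_neqAle eq_sym mulf_neq0 ?h0//= leNgt; apply/negP => shx.
have shc : 0 < s * h c by rewrite /s -normrEsg normr_gt0 h0.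
have cs y : y \in `]a, b[ -> {for y, continuous (fun y => s * h y)}.
  by move=> yab; apply: cvgM; [exact: cvg_cst|exact: ch].
have sub u v : u \in `]a, b[ -> v \in `]a, b[ -> forall y, y \in `[u, v] -> y \in `]a, b[.
  move=> uab vab y; move: uab vab.
  rewrite !in_itv/= => /andP[au _] /andP[_ vb] /andP[/(lt_le_trans au) -> yv] /=.
  exact: le_lt_trans yv vb.
have [y yab yz] : exists2 y, y \in `]a, b[ & s * h y = 0.
  have [cx|xc] := leP c x.
    have [||y ycx yz] := @IVT R (fun y => s * h y) c x 0 cx.
    - apply: continuous_in_subspaceT => y; rewrite inE /= => ycx; apply: cs.
      exact: (sub c x).
    - by rewrite ge_min le_max (ltW shx) (ltW shc) orbT.
    by exists y => //; apply: (sub c x).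
  have [||y ycx yz] := @IVT R (fun y => s * h y) x c 0 (ltW xc).
  - apply: continuous_in_subspaceT => y; rewrite inE /= => ycx; apply: cs.
    exact: (sub x c).
  - by rewrite ge_min le_max (ltW shx) (ltW shc) orbT.
  by exists y => //; apply: (sub x c).
by move/eqP: yz; rewrite mulf_eq0 (negbTE s0) (negbTE (h0 _ yab)).
Qed.

(** * The unique crossing of f with the mean of the two interpolants *)

Theorem theorem4 (R : realType) (m1 m2 n : nat) (a b : R) (f : R -> R)
    (P Q : {poly R})
    (hm : (m2 < m1)%N) (hodd : odd (m1 - m2)) (hn : n = (m1 + m2 + 1)%N)
    (ha : 0 < a) (hab : a < b)
    (hfa : forall k, (k <= m1)%N -> derivable_n_on `[a, b] k f a)
    (hfb : forall k, (k <= m1)%N -> derivable_n_on `[a, b] k f b)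
    (hC : C_on `]a, b[ (n + 2) f)
    (hne : forall x, a < x < b -> derive1n (n + 1) f x != 0)
    (* size p <= n.+1 means degree at most n *)
    (hP : (size P <= n.+1)%N) (hQ : (size Q <= n.+1)%N)
    (hPa : forall j, (j <= m1)%N -> (derivn j P).[a] = derive1n_on `[a, b] j f a)
    (hPb : forall j, (j <= m2)%N -> (derivn j P).[b] = derive1n_on `[a, b] j f b)
    (hQa : forall j, (j <= m2)%N -> (derivn j Q).[a] = derive1n_on `[a, b] j f a)
    (hQb : forall j, (j <= m1)%N -> (derivn j Q).[b] = derive1n_on `[a, b] j f b) :
  exists! x0 : R, a < x0 < b /\ f x0 = 2^-1 * (P.[x0] + Q.[x0]).
Proof.
have df j : (j <= n.+1)%N -> {in `]a, b[, forall x : R, derivable (derive1n j f) x 1}.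
  by move=> jn x xab; apply: (hC x xab).1; rewrite addn2 ltnS.
have cdf j : (j <= n.+1)%N -> {in `]a, b[, forall x : R, {for x, continuous (derive1n j f)}}.
  by move=> jn x xab; exact/differentiable_continuous/derivable1_diffP/df.
have [|s ss sf] := @continuous_neq0_sign R a b (derive1n n.+1 f) hab (cdf _ (leqnn _)).
  by move=> x xab; rewrite -addn1 hne//; rewrite in_itv in xab.
have aab : a <= a <= b by rewrite lexx ltW.
have bab : a <= b <= b by rewrite lexx ltW.
have na : ~ `]a, b[%classic a by rewrite /= in_itv /= ltxx.
have nb : ~ `]a, b[%classic b by rewrite /= in_itv /= ltxx andbF.
have m1n : (m1 <= n)%N by rewrite hn -addnA leq_addr.
have dfj j : (j < m1)%N ->
    forall i, (i < j)%N -> {in `]a, b[, forall x : R, derivable (derive1n i f) x 1}.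
  move=> jm i ij; apply: df; lia.
(* The limit of order [j] comes from differentiability of order [j.+1] at the endpoint, hence the
   strict bound on [j]. *)
have cvga j : (j < m1)%N -> derive1n j f x @[x --> within `]a, b[ (nbhs a)]
    --> derive1n_on `[a, b] j f a.
  by move=> jm; apply: derivable_n_on_cvg; [|exact: dfj|exact: hfa].
have cvgb j : (j < m1)%N -> derive1n j f x @[x --> within `]a, b[ (nbhs b)]
    --> derive1n_on `[a, b] j f b.
  by move=> jm; apply: derivable_n_on_cvg; [|exact: dfj|exact: hfb].
have m1E : m1 = m1.-1.+1 by rewrite prednK// (leq_ltn_trans _ hm).
have df' j : (j <= m1.-1)%N -> {in `]a, b[, forall x : R, derivable (derive1n j f) x 1}.
  by move=> jm; apply: df; lia.
(* [P] meets [m1.+1] conditions at [a], but the exponent is [m1]: the degree of the denominator is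
   then [n], and the condition left over makes [phi] vanish at [a]. The roles of [a] and [b] are
   exchanged for [psi]. *)
pose phi x := (f x - P.[x]) / ((x - a) ^+ m1 * (x - b) ^+ m2.+1).
pose psi x := (f x - Q.[x]) / ((x - a) ^+ m2.+1 * (x - b) ^+ m1).
have incr (u : R -> R) :
    (forall x1 x2, a < x1 -> x1 < x2 -> x2 < b -> exists2 y, y \in `]a, b[ &
      u x2 - u x1 = derive1n n.+1 f y / n.+1`!%:R * (x2 - x1)) ->
    forall x y, a < x -> x < y -> y < b -> s * u x < s * u y.
  move=> slope x y ax xy yb; have [z zab uz] := slope x y ax xy yb.
  rewrite -subr_gt0 -mulrBr uz !mulrA mulr_gt0 ?subr_gt0//.
  by rewrite divr_gt0 ?sf// ltr0n fact_gt0.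
have phi_incr : forall x y, a < x -> x < y -> y < b -> s * phi x < s * phi y.
  apply: incr; apply: hermite_quotient_slope => //.
  - by rewrite hn addn1 addnS.
  - by move=> j jn; apply: df; rewrite leqW.
  - by move=> j jm; rewrite hPa ?(ltnW jm)//; exact: cvga.
  - by move=> j jm; rewrite hPb//; apply: cvgb; exact: leq_trans hm.
have psi_incr : forall x y, a < x -> x < y -> y < b -> s * psi x < s * psi y.
  apply: incr; apply: hermite_quotient_slope => //.
  - by rewrite hn addn1 addSn addnC.
  - by move=> j jn; apply: df; rewrite leqW.
  - by move=> j jm; rewrite hQa//; apply: cvga; exact: leq_trans hm.
  - by move=> j jm; rewrite hQb ?(ltnW jm)//; exact: cvgb.
have sabs u : `|s * u| = `|u|.
  have s1 : `|s| = 1.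
    by apply/eqP; rewrite -(@sqrp_eq1 _ `|s|) ?normr_ge0// -normrX expr2 ss normr1.
  by rewrite normrM s1 mul1r.
have phi0 e : 0 < e -> exists2 d, 0 < d &
    forall y, a < y < b -> `|y - a| < d -> `|s * phi y| <= e.
  move=> e0; have peano : forall e, 0 < e -> \forall y \near within `]a, b[ (nbhs a),
      `|f y - P.[y]| <= e * `|y - a| ^+ m1.
    by rewrite m1E; apply: hermite_endpoint => // j; rewrite -m1E; [exact: hfa|exact: hPa].
  have [|d d0 dphi] := @hermite_quotient_vanishing R a b a b f P m1 m2.+1 _ peano e e0.
    by rewrite lt_eqF.
  exists d => // y yab ya; rewrite sabs; apply: dphi => //.
  by rewrite gt_eqF//; case/andP: yab.
have psi0 e : 0 < e -> exists2 d, 0 < d &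
    forall y, a < y < b -> `|y - b| < d -> `|s * psi y| <= e.
  move=> e0; have peano : forall e, 0 < e -> \forall y \near within `]a, b[ (nbhs b),
      `|f y - Q.[y]| <= e * `|y - b| ^+ m1.
    by rewrite m1E; apply: hermite_endpoint => // j; rewrite -m1E; [exact: hfb|exact: hQb].
  have [|d d0 dpsi] := @hermite_quotient_vanishing R a b b a f Q m1 m2.+1 _ peano e e0.
    by rewrite gt_eqF.
  exists d => // y yab yb; rewrite sabs /psi [X in _ / X]mulrC; apply: dpsi => //.
  by rewrite lt_eqF//; case/andP: yab.
(* The parity assumption enters here: it makes the excess of [m1] over [m2.+1] even, so [(x - b)]
   and [(b - x)] have the same power of that order. *)
have [l dl] : exists l, m1 = (l.*2 + m2.+1)%N.
  exists (m1 - m2.+1)./2; rewrite -[in LHS](subnK hm); congr (_ + _)%N.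
  by have := odd_double_half (m1 - m2.+1); rewrite subnS; lia.
pose h x := (x - a) ^+ l.*2 * (s * phi x) + (b - x) ^+ l.*2 * (s * psi x).
have [h_incr [x1 x1ab hx1] [x2 x2ab hx2]] :
    [/\ forall x y, a < x -> x < y -> y < b -> h x < h y,
      exists2 x, a < x < b & h x < 0 & exists2 x, a < x < b & 0 < h x].
  exact: balance_sign_change hab phi_incr psi_incr phi0 psi0.
pose w x := ((x - a) * (b - x)) ^+ m2.+1.
(* The factor [(-1) ^+ m2.+1] absorbs the sign from writing [(x - b) ^+ m2.+1] with [b - x], so that
   [g] is the positive weight [w] times [h]. *)
pose g x := (-1) ^+ m2.+1 * s * (f x - P.[x] + (f x - Q.[x])).
have w0 x : a < x < b -> 0 < w x.
  by move=> /andP[ax xb]; rewrite exprn_gt0// mulr_gt0 ?subr_gt0.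
have gE x : a < x < b -> g x = w x * h x.
  move=> /andP[ax xb].
  have xa0 : x - a != 0 by rewrite subr_eq0 gt_eqF.
  have xb0 : x - b != 0 by rewrite subr_eq0 lt_eqF.
  rewrite /g; have -> : f x - P.[x] = phi x * ((x - a) ^+ m1 * (x - b) ^+ m2.+1).
    by rewrite divfK// mulf_neq0 ?expf_neq0.
  have -> : f x - Q.[x] = psi x * ((x - a) ^+ m2.+1 * (x - b) ^+ m1).
    by rewrite divfK// mulf_neq0 ?expf_neq0.
  have e1 : ((-1) ^+ m2.+1 * (-1) ^+ m2.+1 = 1 :> R).
    by rewrite -exprMn mulrNN mul1r expr1n.
  have eb : (x - b) ^+ m2.+1 = (-1) ^+ m2.+1 * (b - x) ^+ m2.+1.
    by rewrite -(opprB b x) (exprNn (b - x)).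
  have el : (x - b) ^+ l.*2 = (b - x) ^+ l.*2.
    by rewrite -(opprB b x) (exprNn (b - x)) -signr_odd odd_double mul1r.
  rewrite /w /h dl !exprD eb el exprMn.
  transitivity ((-1) ^+ m2.+1 * (-1) ^+ m2.+1 *
    ((x - a) ^+ m2.+1 * (b - x) ^+ m2.+1 *
     ((x - a) ^+ l.*2 * (s * phi x) + (b - x) ^+ l.*2 * (s * psi x)))).
    move: ((-1) ^+ m2.+1) ((x - a) ^+ m2.+1) ((b - x) ^+ m2.+1) ((x - a) ^+ l.*2)
      ((b - x) ^+ l.*2) (phi x) (psi x) => *; ring.
  by rewrite e1 mul1r.
have cg x : a < x < b -> {for x, continuous g}.
  move=> xab; have xi : x \in `]a, b[ by rewrite in_itv.
  have cf : {for x, continuous f} by exact: (cdf 0%N isT x xi).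
  have cp (p : {poly R}) : {for x, continuous (horner p)}.
    exact/differentiable_continuous/derivable1_diffP/derivable_horner.
  by apply: cvgM; [exact: cvg_cst|apply: cvgD; apply: cvgB => //; exact: cp].
have [x0 x0ab gx0] : exists2 x0, a < x0 < b & g x0 = 0.
  have gx1 : g x1 < 0 by rewrite gE// pmulr_rlt0// w0.
  have gx2 : 0 < g x2 by rewrite gE// pmulr_rgt0// w0.
  have x12 : x1 < x2.
    have [//|x21|x12] := ltgtP x1 x2.
      have /andP[_ x1b] := x1ab; have /andP[ax2 _] := x2ab.
      by have := h_incr _ _ ax2 x21 x1b; rewrite ltNge (ltW (lt_trans hx1 hx2)).
    by rewrite x12 in hx1; have := lt_trans hx1 hx2; rewrite ltxx.
  have xab y : y \in `[x1, x2] -> a < y < b.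
    rewrite in_itv/=; case/andP: x1ab x2ab => ax1 _ /andP[_ x2b] /andP[x1y yx2].
    by rewrite (lt_le_trans ax1 x1y) (le_lt_trans yx2 x2b).
  have [||y yx gy] := @IVT R g x1 x2 0 (ltW x12).
  - by apply: continuous_in_subspaceT => y; rewrite inE => /xab/cg.
  - by rewrite ge_min le_max (ltW gx1) (ltW gx2) orbT.
  by exists y => //; exact: xab.
have s0 : s != 0 by apply: contraTneq (oner_neq0 R) => sz; rewrite -ss sz mul0r eqxx.
have gmid x : g x = 0 <-> f x = 2^-1 * (P.[x] + Q.[x]).
  split=> [/eqP|fx].
    rewrite /g mulf_eq0 mulf_eq0 signr_eq0 (negbTE s0) /= => /eqP.
    by move: (f x) P.[x] Q.[x] => u v z; lra.
  have e0 : f x - P.[x] + (f x - Q.[x]) = 0 by rewrite fx; field.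
  by rewrite /g e0 mulr0.
exists x0; split; first by split=> //; exact/gmid.
move=> y [yab /gmid gy].
(* [g] itself need not be monotone; uniqueness is transferred to the strictly increasing [h], which
   has the same zeros. *)
have hz z : a < z < b -> g z = 0 -> h z = 0.
  by move=> zab; rewrite gE// => /eqP; rewrite mulf_eq0 gt_eqF ?w0//= => /eqP.
have hx0 := hz _ x0ab gx0; have hy := hz _ yab gy.
have [ax0 x0b] := andP x0ab; have [ay yb] := andP yab.
have [x0y|yx0|//] := ltgtP x0 y.
  by have := h_incr _ _ ax0 x0y yb; rewrite hx0 hy ltxx.
by have := h_incr _ _ ay yx0 x0b; rewrite hx0 hy ltxx.
Qed.
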